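(* Let $\nu>0$, let $\mathbf{x}_0\in\mathbb{R}^n$, and let $\Theta=\{\mathbf{x}_1,\dots,\mathbf{x}_{n+1}\}\subset\mathbb{R}^n$ be a set of $n+1$ affinely independent vectors. Then the optimal value $z(\Theta,\mathbf{x}_0)$ of the problem of maximizing $|\hat f(\mathbf{x}_0)-f(\mathbf{x}_0)|$ over all $f\in C^{1,1}_\nu(\mathbb{R}^n)$ is equal to the optimal value of the finite-dimensional problem of maximizing $$\sum_{i=0}^{n+1}\ell_i(\mathbf{x}_0)\,y_i$$ over $y_0,\dots,y_{n+1}\in\mathbb{R}$ and $\mathbf{g}_0,\dots,\mathbf{g}_{n+1}\in\mathbb{R}^n$ subject to $$y_j\le y_i+\frac12(\mathbf{g}_i+\mathbf{g}_j)\cdot(\mathbf{x}_j-\mathbf{x}_i)+\frac{\nu}{4}\|\mathbf{x}_j-\mathbf{x}_i\|^2-\frac1{4\nu}\|\mathbf{g}_j-\mathbf{g}_i\|^2\quad\text{for all }i,j\in\{0,\dots,n+1\}.$$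
   Context: $\|\cdot\|$ is the Euclidean norm. $C^{1,1}_\nu(\mathbb{R}^n)$ is the class of continuously differentiable functions $f:\mathbb{R}^n\to\mathbb{R}$ with $\|Df(\mathbf{u})-Df(\mathbf{v})\|\le\nu\|\mathbf{u}-\mathbf{v}\|$ for all $\mathbf{u},\mathbf{v}\in\mathbb{R}^n$. For each $f$, $\hat f$ is the unique affine function with $\hat f(\mathbf{x}_i)=f(\mathbf{x}_i)$ for $i=1,\dots,n+1$. For $i=1,\dots,n+1$, $\ell_i$ is the Lagrange polynomial of $\Theta$: the unique affine function with $\ell_i(\mathbf{x}_j)=1$ if $j=i$ and $0$ if $j\ne i$ ($j=1,\dots,n+1$); additionally $\ell_0\equiv-1$. *)

(* Defs.v *)
From HB Require Import structures.
From mathcomp Require Import all_boot all_order all_algebra.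
From mathcomp Require Import all_classical all_reals all_analysis.

Set Implicit Arguments.
Unset Strict Implicit.
Unset Printing Implicit Defensive.

Import Order.TTheory GRing.Theory Num.Theory.
Import numFieldNormedType.Exports.

Local Open Scope classical_set_scope.
Local Open Scope ring_scope.

Definition dot (R : realType) (n : nat) (u v : 'rV[R]_n) : R :=
  \sum_(i < n) u 0 i * v 0 i.

(* The library norm `|u| on 'rV[R]_n is the sup norm, hence a separate
   Euclidean norm.  The two induce the same topology, so that the library's
   [continuous] and [differentiable] have their usual meaning on R^n. *)
Definition enorm (R : realType) (n : nat) (u : 'rV[R]_n) : R :=
  Num.sqrt (dot u u).

Definition grad (R : realType) (n : nat) (f : 'rV[R]_n -> R) (u : 'rV[R]_n) :
    'rV[R]_n :=
  \row_(i < n) 'D_(delta_mx 0 i) f u.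

Definition C11 (R : realType) (n : nat) (nu : R) : set ('rV[R]_n -> R) :=
  [set f | [/\ forall u, differentiable f u,
               continuous (grad f) &
               forall u v, enorm (grad f u - grad f v) <= nu * enorm (u - v)]].

Definition is_affine (R : realType) (n : nat) (p : 'rV[R]_n -> R) : Prop :=
  exists (L : {scalar 'rV[R]_n}) (c : R), forall x, p x = L x + c.

Definition affinely_independent (R : realType) (m n : nat)
    (X : 'I_m.+1 -> 'rV[R]_n) : Prop :=
  free [seq X (lift ord0 i) - X ord0 | i <- enum 'I_m].

Definition interpolates (R : realType) (n : nat) (X : 'I_n.+1 -> 'rV[R]_n)
    (y : 'I_n.+1 -> R) (p : 'rV[R]_n -> R) : Prop :=
  is_affine p /\ forall i, p (X i) = y i.

(* "The" affine function with values y on X, as a definite description; it is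
   meaningful when X is affinely independent, see [affine_interpolantP]. *)
Definition affine_interpolant (R : realType) (n : nat)
    (X : 'I_n.+1 -> 'rV[R]_n) (y : 'I_n.+1 -> R) : 'rV[R]_n -> R :=
  xget (fun=> 0) [set p | interpolates X y p].

Definition lagrange (R : realType) (n : nat) (X : 'I_n.+1 -> 'rV[R]_n)
    (i : 'I_n.+1) : 'rV[R]_n -> R :=
  affine_interpolant X (fun j => (j == i)%:R).

(* The families indexed by 0, ..., n+1: index [ord0] is 0, and [lift ord0 i]
   is the index of the i-th element of Theta. *)
Definition points (R : realType) (n : nat) (x0 : 'rV[R]_n)
    (X : 'I_n.+1 -> 'rV[R]_n) (i : 'I_n.+2) : 'rV[R]_n :=
  if unlift ord0 i is Some j then X j else x0.

Definition ell (R : realType) (n : nat) (X : 'I_n.+1 -> 'rV[R]_n)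
    (i : 'I_n.+2) : 'rV[R]_n -> R :=
  if unlift ord0 i is Some j then lagrange X j else fun=> -1.

Definition worst_error (R : realType) (n : nat) (nu : R) (x0 : 'rV[R]_n)
    (X : 'I_n.+1 -> 'rV[R]_n) : \bar R :=
  ereal_sup [set (`|affine_interpolant X (f \o X) x0 - f x0|)%:E
            | f in C11 nu].

Definition feasible (R : realType) (n m : nat) (nu : R)
    (x : 'I_m -> 'rV[R]_n) (y : 'I_m -> R) (g : 'I_m -> 'rV[R]_n) : Prop :=
  forall i j,
    y j <= y i + 2^-1 * dot (g i + g j) (x j - x i)
           + nu / 4 * enorm (x j - x i) ^+ 2
           - (4 * nu)^-1 * enorm (g j - g i) ^+ 2.

Definition finite_optimum (R : realType) (n : nat) (nu : R) (x0 : 'rV[R]_n)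
    (X : 'I_n.+1 -> 'rV[R]_n) : \bar R :=
  ereal_sup [set z | exists (y : 'I_n.+2 -> R) (g : 'I_n.+2 -> 'rV[R]_n),
    feasible nu (points x0 X) y g /\
    z = (\sum_(i < n.+2) ell X i x0 * y i)%:E].

Lemma interpolates_exists_unique (R : realType) (n : nat)
    (X : 'I_n.+1 -> 'rV[R]_n) (y : 'I_n.+1 -> R) :
  affinely_independent X -> exists! p, interpolates X y p.
Proof.
move=> freeX; pose M := \matrix_(i < n) (X (lift ord0 i) - X ord0).
have uM : M \in unitmx.
  rewrite -row_free_unit; apply: inj_row_free => v vM.
  move: freeX; rewrite /affinely_independent.
  pose t := [tuple X (lift ord0 i) - X ord0 | i < n].
  rewrite (_ : [seq _ | _ <- _] = t) //; move/freeP => /(_ (v 0)) t0.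
  apply/rowP => i; rewrite mxE; apply: t0; rewrite -[RHS]vM mulmx_sum_row.
  by apply: eq_bigr => j _; rewrite -tnth_nth tnth_mktuple rowK.
pose d := \col_(i < n) (y (lift ord0 i) - y ord0).
pose L (x : 'rV[R]_n) : R := (x *m invmx M *m d) 0 0.
have Llin : linear_for *%R L.
  by move=> a u v; rewrite /L !mulmxDl -!scalemxAl !mxE.
pose HL := GRing.isLinear.Build _ _ _ _ L Llin.
pose L' : {scalar 'rV[R]_n} := HB.pack L HL.
have LE x (K : {scalar 'rV[R]_n}) c : (forall i, K (X i) + c = y i) ->
    K x + c = L (x - X ord0) + y ord0.
  move=> Ky; pose w := (x - X ord0) *m invmx M.
  have xE : x = w *m M + X ord0 by rewrite /w mulmxKV // subrK.
  rewrite {1}xE linearD -addrA Ky /L -/w mulmx_sum_row linear_sum mxE.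
  congr (_ + _); apply: eq_bigr => i _.
  by rewrite linearZ /= rowK linearB /= !mxE -!Ky opprD addrACA subrr addr0.
exists (fun x => L (x - X ord0) + y ord0); split; last first.
  by move=> p [[K [c pE]] py]; apply/funext => x; rewrite pE (@LE x K c)// => i;
    rewrite -pE.
split.
  exists L', (y ord0 - L (X ord0)) => x.
  by rewrite [L _](linearB L') /= addrA addrAC.
move=> i; have [j ->|->] := unliftP ord0 i; last first.
  by rewrite subrr [L 0](linear0 L') add0r.
have -> : X (lift ord0 j) - X ord0 = delta_mx 0 j *m M.
  by rewrite -rowE rowK.
by rewrite /L mulmxK // -rowE !mxE subrK.
Qed.

Lemma affine_interpolantP (R : realType) (n : nat) (X : 'I_n.+1 -> 'rV[R]_n)
    (y : 'I_n.+1 -> R) (p : 'rV[R]_n -> R) :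
  affinely_independent X ->
  interpolates X y p <-> p = affine_interpolant X y.
Proof.
move=> /(interpolates_exists_unique y)[q [qP qu]].
have aP : interpolates X y (affine_interpolant X y) by apply: xgetI qP.
by split=> [pP|->//]; rewrite -(qu _ pP) -(qu _ aP).
Qed.

(* Main.v *)
Require Import Defs.
From HB Require Import structures.
From mathcomp Require Import all_boot all_order all_algebra.
From mathcomp Require Import all_classical all_reals all_analysis.
From mathcomp Require Import ring lra.

(** Both optima are suprema over the same set of numbers, up to sign.  With
[ell_0 = -1], the linear objective at [y_i = f x_i] is the signed error
[hat f x0 - f x0] ([sum_ell_comp]), because [hat f] is the combination of the
Lagrange polynomials weighted by the values of [f].  As the class [C11 nu] is
closed under opposite, the absolute value is harmless.  So it suffices that
the feasible pairs [(y, g)] have as [y] exactly the value vectors of the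
functions of [C11 nu].

Values and gradients of such an [f] are feasible ([C11_feasible]).  At any
point [w], the quadratic upper bound of [f] at [x_i] dominates the quadratic
lower bound of [f] at [x_j] ([descent] for [f] and for [- f]); the [w] at which
the gap between the two is smallest gives the constraint for [(i, j)].

Conversely, feasible data are interpolated ([C11_interpolation]).  Adding
[nu/2 |x|^2] turns the problem into interpolation by a convex function whose
gradient is [L]-Lipschitz, with [L = 2 nu], and the constraints into
  [y_k + g_k . (x_i - x_k) + |g_k - g_i|^2 / (2 L) <= y_i].
This is solved by the Legendre conjugate of a maximum of paraboloids:
  [H z = max_p min_i (y_i + p . (z - x_i) - |p - g_i|^2 / (2 L))].
The constraints say that [p = g_k] attains the value [y_k] at [z = x_k], while
the [i = k] term never exceeds [y_k] there.  The minimum is strongly concave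
in [p], so its maximizer [G z] exists, is a subgradient of [H] at [z], and is
cocoercive in [z] ([smooth_convex_interpolation]).  Cocoercivity yields the
differentiability of [H] and also the Lipschitz constant [nu] for
[G z - nu z], the gradient of [H - nu/2 |.|^2]. *)

Import Order.TTheory GRing.Theory Num.Theory.
Import numFieldNormedType.Exports.

Local Open Scope ring_scope.

(** * The Euclidean inner product *)

Section Dot.
Context {R : realType} {n : nat}.
Implicit Types (u v w : 'rV[R]_n) (a : R).

Lemma dotC u v : dot u v = dot v u.
Proof. by apply: eq_bigr => i _; rewrite mulrC. Qed.

Lemma dotDl u v w : dot (u + v) w = dot u w + dot v w.
Proof. by rewrite -big_split; apply: eq_bigr => i _; rewrite mxE mulrDl. Qed.

Lemma dotZl a u v : dot (a *: u) v = a * dot u v.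
Proof. by rewrite mulr_sumr; apply: eq_bigr => i _; rewrite mxE mulrA. Qed.

Lemma dotNl u v : dot (- u) v = - dot u v.
Proof. by rewrite -scaleN1r dotZl mulN1r. Qed.

Lemma dotDr u v w : dot w (u + v) = dot w u + dot w v.
Proof. by rewrite !(dotC w) dotDl. Qed.

Lemma dotZr a u v : dot v (a *: u) = a * dot v u.
Proof. by rewrite !(dotC v) dotZl. Qed.

Lemma dotNr u v : dot v (- u) = - dot v u.
Proof. by rewrite !(dotC v) dotNl. Qed.

Definition dotE := (dotDl, dotDr, dotZl, dotZr, dotNl, dotNr).

Lemma dot_ge0 u : 0 <= dot u u.
Proof. by apply: sumr_ge0 => i _; rewrite -expr2 sqr_ge0. Qed.

Lemma sqr_enorm u : enorm u ^+ 2 = dot u u.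
Proof. by rewrite sqr_sqrtr ?dot_ge0. Qed.

Lemma enorm_leP a u v : 0 <= a ->
  (enorm u <= a * enorm v) = (dot u u <= a ^+ 2 * dot v v).
Proof.
move=> a0; rewrite -!sqr_enorm -exprMn ler_pXn2r// nnegrE ?sqrtr_ge0//.
by rewrite mulr_ge0 ?sqrtr_ge0.
Qed.

(** Expand [0 <= |u - a v|^2] and divide by [a].  This weighted form replaces
the Cauchy-Schwarz inequality throughout. *)
Lemma dot_young a u v : 0 < a -> 2 * dot u v <= a^-1 * dot u u + a * dot v v.
Proof.
move=> a0; have := dot_ge0 (u - a *: v).
rewrite !dotE (dotC v u) => h.
rewrite -(ler_pM2l a0) mulrDr mulVKf ?gt_eqF//.
by move: h; rewrite -subr_ge0; congr (0 <= _); ring.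
Qed.

(** With [dot_le_sqr_norm], this compares the Euclidean norm with the sup norm
that defines the topology of ['rV[R]_n]. *)
Lemma sqr_norm_le_dot u : `|u| ^+ 2 <= dot u u.
Proof.
have [->|u0] := eqVneq u 0; first by rewrite normr0 expr0n dot_ge0.
have [[i j] /=] : exists i, `|u| = `|u i.1 i.2|.
  by apply: mx_norm_neq0; rewrite -[mx_norm u]/`|u| normr_eq0.
rewrite ord1 => ->; rewrite real_normK ?num_real// expr2 /dot (bigD1 j)//= lerDl.
by apply: sumr_ge0 => k _; rewrite -expr2 sqr_ge0.
Qed.

Lemma coord_le_norm u i : `|u 0 i| <= `|u|.
Proof.
by rewrite [leRHS]/Num.norm /= mx_normrE; apply/bigmax_geP; right; exists (0, i).
Qed.

Lemma dot_le_sqr_norm u : dot u u <= n%:R * `|u| ^+ 2.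
Proof.
rewrite mulr_natl -[X in _ *+ X](card_ord n) -sumr_const; apply: ler_sum => i _.
by rewrite -expr2 -real_normK ?num_real// ler_pXn2r ?nnegrE// coord_le_norm.
Qed.

End Dot.

(** * Gradients with respect to the Euclidean inner product *)

Section Gradient.
Context {R : realType} {n : nat}.
Implicit Types (f : 'rV[R]_n -> R) (u v : 'rV[R]_n).

Lemma dot_lin u : linear_for *%R (dot u).
Proof. by move=> a v w; rewrite !dotE. Qed.

Lemma continuous_dot u : continuous (dot u).
Proof.
have cD := @continuous_big R^o 'I_n +%R 0 xpredT (@add_continuous _).
apply: (cD 'rV[R]_n (index_enum _) (fun i v => u 0 i * v 0 i)) => i _ v.
by apply: cvgMl_tmp; [exact: nbhs_filter|exact: coord_continuous].
Qed.

Lemma diff_grad f u v : differentiable f u -> 'd f u v = dot (grad f u) v.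
Proof.
move=> df; rewrite {1}[v]row_sum_delta linear_sum; apply: eq_bigr => i _.
by rewrite linearZ /= mxE deriveE// mulrC.
Qed.

(** A remainder that is quadratic in the Euclidean norm is a little-o of the
sup norm, hence [dot p] is the differential; reading it on the basis vectors
identifies [grad f u]. *)
Lemma quadratic_remainder_grad (C : R) f u p :
  (forall h, `|f (u + h) - f u - dot p h| <= C * dot h h) ->
  differentiable f u /\ grad f u = p.
Proof.
move=> fC.
pose Hp := GRing.isLinear.Build _ _ _ _ (dot p) (dot_lin p).
pose P : {scalar 'rV[R]_n} := HB.pack (dot p) Hp.
have cP : continuous P := continuous_dot p.
have fP : (f \o shift u : 'rV[R]_n -> R) =
    (cst (f u) + (P : 'rV[R]_n -> R) : 'rV[R]_n -> R) +o_ (0 : 'rV[R]_n) id.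
  apply/eqaddoP => _/posnumP[e].
  (* [|C| n] bounds the remainder in the sup norm; [+ 1] makes [K] positive. *)
  pose K := `|C| * n%:R + 1.
  have K0 : 0 < K by rewrite ltr_wpDl ?mulr_ge0.
  have eK : 0 < e%:num / K by rewrite divr_gt0.
  near=> h => /=.
  have he : `|h| <= e%:num / K.
    by near: h; rewrite nbhs_simpl; exact: (@nbhs0_le R 'rV[R]_n _ eK).
  rewrite -[X in `|X|]/(f (h + u) - (f u + dot p h)) opprD addrA addrC.
  rewrite [h + u]addrC addrC.
  apply: le_trans (fC h) _; apply: le_trans (_ : K * `|h| ^+ 2 <= _); last first.
    by rewrite expr2 mulrA ler_wpM2r// mulrC -ler_pdivlMr.
  apply: le_trans (_ : `|C| * dot h h <= _).
    by rewrite ler_wpM2r ?dot_ge0// ler_norm.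
  apply: le_trans (_ : `|C| * (n%:R * `|h| ^+ 2) <= _).
    by rewrite ler_wpM2l// dot_le_sqr_norm.
  by rewrite mulrA ler_wpM2r ?sqr_ge0// lerDl.
have dP := diff_unique cP fP.
have df : differentiable f u by apply/diff_locallyP; rewrite dP.
split => //; apply/rowP => i; rewrite mxE deriveE// dP /= /dot (bigD1 i)//=.
rewrite mxE !eqxx mulr1 big1 ?addr0// => j ji.
by rewrite mxE (negbTE ji) andbF mulr0.
Unshelve. all: by end_near. Qed.

Lemma lipschitz_continuous (F : 'rV[R]_n -> 'rV[R]_n) (K : R) :
  (forall u v, dot (F u - F v) (F u - F v) <= K * dot (u - v) (u - v)) ->
  continuous F.
Proof.
move=> FK u; apply/(cvgrPdist_le (FF := nbhs_filter u)) => e e0.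
(* [1 <= M] makes [M] an upper bound for the square root of [|K| n]. *)
pose M := `|K| * n%:R + 1.
have M0 : 0 < M by rewrite ltr_wpDl ?mulr_ge0.
have M1 : 1 <= M by rewrite lerDr mulr_ge0.
have eM : 0 < e / M by rewrite divr_gt0.
near=> v.
have : `|u - v| <= e / M.
  near: v; rewrite nbhs_simpl.
  exact: (@cvgr_dist_le _ _ _ _ (nbhs_filter u) id u cvg_id _ eM).
rewrite ler_pdivlMr// => uv.
rewrite -(@ler_pXn2r _ 2)// ?nnegrE ?(ltW e0)//.
apply: le_trans (sqr_norm_le_dot (F u - F v)) _; apply: le_trans (FK _ _) _.
apply: le_trans (_ : `|K| * (n%:R * `|u - v| ^+ 2) <= _).
  apply: le_trans (_ : `|K| * dot (u - v) (u - v) <= _).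
    by rewrite ler_wpM2r ?dot_ge0// ler_norm.
  by rewrite ler_wpM2l// dot_le_sqr_norm.
apply: le_trans (_ : (`|u - v| * M) ^+ 2 <= _); last first.
  by rewrite ler_pXn2r ?nnegrE ?mulr_ge0// ltW.
rewrite mulrA exprMn mulrC ler_wpM2l ?sqr_ge0//.
apply: le_trans (_ : M <= _); first by rewrite lerDl.
by rewrite expr2 ler_peMr// ltW.
Unshelve. all: by end_near. Qed.

End Gradient.

(** Continuity of the gradient is a consequence of the Lipschitz bound. *)
Lemma lipschitz_grad_C11 (R : realType) (n : nat) (nu : R) (f : 'rV[R]_n -> R) :
  0 <= nu -> (forall u, differentiable f u) ->
  (forall u v, dot (grad f u - grad f v) (grad f u - grad f v)
               <= nu ^+ 2 * dot (u - v) (u - v)) ->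
  C11 nu f.
Proof.
move=> nu0 df lf; split=> // [|u v]; first exact: lipschitz_continuous lf.
by rewrite enorm_leP.
Qed.

(** * Quadratic bounds and necessity of the constraints *)

Section Descent.
Context {R : realType} {n : nat}.
Implicit Types (f : 'rV[R]_n -> R) (u v h : 'rV[R]_n).

Lemma is_derive_along_line f u h (t : R) : (forall w, differentiable f w) ->
  is_derive t 1 (fun s : R => f (s *: h + u)) (dot (grad f (t *: h + u)) h).
Proof.
move=> df; pose c (s : R) := s *: h + u.
have dc : is_diff t c ( *:%R^~ h).
  by apply: is_diff_eq; rewrite addr0.
have dfc : differentiable (f \o c) t by exact: differentiable_comp.
apply: DeriveDef; first exact/diff_derivable.
by rewrite deriveE// diff_comp//= diff_val scale1r diff_grad.
Qed.

Lemma grad_opp f u : differentiable f u -> grad (- f) u = - grad f u.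
Proof.
by move=> df; apply/rowP => i; rewrite !mxE deriveN//; exact: diff_derivable.
Qed.

Lemma C11_opp (nu : R) f : 0 <= nu -> C11 nu f -> C11 nu (- f).
Proof.
move=> nu0 [df _ lf]; apply: lipschitz_grad_C11 => // [u|u v].
  exact: differentiableN.
have := lf u v; rewrite enorm_leP// !grad_opp// -opprD.
by rewrite dotNl dotNr opprK.
Qed.

(** Along the segment from [u] to [v], the difference between [f] and the
quadratic bound has a nonpositive derivative, since the gradient moves by at
most [nu t |v - u|]; the mean value theorem concludes. *)
Lemma descent (nu : R) f u v : 0 < nu -> C11 nu f ->
  f v <= f u + dot (grad f u) (v - u) + nu / 2 * dot (v - u) (v - u).
Proof.
move=> nu0 [df _ lg]; set h := v - u.
pose a := dot (grad f u) h; pose b := nu / 2 * dot h h.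
pose phi (t : R) := f (t *: h + u) - (t * a + t ^+ 2 * b).
have dphi (t : R) : is_derive t 1 phi
    (dot (grad f (t *: h + u)) h - (a + 2 * t * b)).
  have := is_derive_along_line f u h t df => d1.
  have d2 : is_derive t 1 (fun s : R => s * a + s ^+ 2 * b) (a + 2 * t * b).
    apply: is_derive_eq.
    by rewrite !scaler0 !add0r /GRing.scale /=; ring.
  exact: is_deriveB.
have cphi : {within `[0, 1], continuous phi}%classic.
  apply: continuous_subspaceT => t.
  by apply/differentiable_continuous/derivable1_diffP; exact: ex_derive.
have [t /[!in_itv]/= /andP[t0 _]] := MVT ltr01 (fun t _ => dphi t) cphi.
rewrite subr0 mulr1.
have : dot (grad f (t *: h + u)) h - (a + 2 * t * b) <= 0.
  have nut : 0 < nu * t by rewrite mulr_gt0.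
  pose p := grad f (t *: h + u) - grad f u.
  have pD : dot p h = dot (grad f (t *: h + u)) h - a by rewrite dotDl dotNl.
  (* The weight [nu t] equalizes the two terms of the bound on [p . h]. *)
  have := dot_young (nu * t) p h nut; rewrite pD.
  have := lg (t *: h + u) u.
  rewrite enorm_leP ?(ltW nu0)// addrK dotZl dotZr -/p => lp.
  have : (nu * t)^-1 * dot p p <= nu * t * dot h h.
    rewrite ler_pdivrMl//; apply: le_trans lp _.
    by rewrite le_eqVlt; apply/orP; left; apply/eqP; ring.
  by rewrite /b; lra.
move=> d0 phi1; move: d0; rewrite -phi1 /phi !scale1r !scale0r add0r subrK.
by rewrite /a /b; lra.
Qed.

(** The upper bound of [f] at [x i] and the lower bound at [x j], both evaluated
at the same point [w], bracket [f w]. *)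
Lemma C11_feasible (m : nat) (nu : R) (x : 'I_m -> 'rV[R]_n) f :
  0 < nu -> C11 nu f -> feasible nu x (f \o x) (grad f \o x).
Proof.
move=> nu0 fC i j /=; set gi := grad f (x i); set gj := grad f (x j).
(* [w] minimizes the upper bound at [x i] minus the lower bound at [x j]. *)
pose w := 2^-1 *: (x i + x j) - (2 * nu)^-1 *: (gi - gj).
have := descent nu f (x i) w nu0 fC.
have := descent nu (- f) (x j) w nu0 (C11_opp nu f (ltW nu0) fC).
have [df _ _] := fC.
rewrite grad_opp// -/gj.
rewrite -/gi -!sqr_enorm !opprfctE !sqr_enorm /w !dotE.
rewrite (dotC gj gi) (dotC (x j) (x i)) !(dotC (x i) gi) !(dotC (x j) gj).
rewrite !(dotC (x i) gj) !(dotC (x j) gi).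
move=> h1 h2; have := lerD h1 h2.
rewrite -subr_ge0 => h; rewrite -subr_ge0; apply: le_trans h _.
rewrite le_eqVlt; apply/orP; left; apply/eqP.
by field; rewrite gt_eqF.
Qed.

End Descent.

(** * Convex interpolation by a conjugate function *)

Section MinFamily.
Context {R : realType} {T : topologicalType} {m : nat}.
Variable F : 'I_m.+1 -> T -> R.

(** The default value [F ord0 t] belongs to the family, so that this is its
genuine minimum. *)
Definition min_family (t : T) : R := \big[Num.min/F ord0 t]_i F i t.

Lemma min_family_le i t : min_family t <= F i t.
Proof. exact: bigmin_le. Qed.

Lemma le_min_family c t : (forall i, c <= F i t) -> c <= min_family t.
Proof. by move=> cF; apply: le_bigmin. Qed.

Lemma continuous_min_family : (forall i, continuous (F i)) ->
  continuous min_family.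
Proof.
move=> cF t; rewrite /min_family.
elim: (index_enum _) => [|i s IHs].
  have -> : (fun t => \big[Num.min/F ord0 t]_(i <- [::]) F i t) = F ord0.
    by apply/funext => u; rewrite big_nil.
  exact: cF.
have -> : (fun t => \big[Num.min/F ord0 t]_(j <- i :: s) F j t) =
    (F i \min (fun t => \big[Num.min/F ord0 t]_(j <- s) F j t)).
  by apply/funext => u; rewrite big_cons.
by apply: continuous_min; [exact: cF|exact: IHs].
Qed.

End MinFamily.

Section Interpolation.
Context {R : realType} {n m : nat}.
Variable L : R.
Hypothesis L_gt0 : 0 < L.
Implicit Types (p q z : 'rV[R]_n) (g x : 'I_m.+1 -> 'rV[R]_n) (y : 'I_m.+1 -> R).

(** A concave paraboloid in [p] of curvature [- 1 / L], whatever the linear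
part; [c], [a], [b] stand for a value, a displacement and a gradient. *)
Definition paraboloid (c : R) (a b p : 'rV[R]_n) : R :=
  c + dot p a - (2 * L)^-1 * dot (p - b) (p - b).

Lemma continuous_paraboloid c a b : continuous (paraboloid c a b).
Proof.
move=> p; apply: differentiable_continuous.
have [|//] := @quadratic_remainder_grad R n (2 * L)^-1 (paraboloid c a b) p
  (a - L^-1 *: (p - b)).
move=> h; have -> : paraboloid c a b (p + h) - paraboloid c a b p
    - dot (a - L^-1 *: (p - b)) h = - ((2 * L)^-1 * dot h h).
  rewrite /paraboloid !dotE (dotC h a) (dotC h p) (dotC h b).
  by field; rewrite gt_eqF.
by rewrite normrN ger0_norm// mulr_ge0 ?dot_ge0// invr_ge0 mulr_ge0// ltW.
Qed.

(** Strong concavity as an identity: the defect from affinity on a segment does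
not depend on [c], [a], [b], and hence survives a minimum over a family. *)
Lemma paraboloid_segment c a b p q (t : R) :
  paraboloid c a b (p + t *: (q - p)) =
  (1 - t) * paraboloid c a b p + t * paraboloid c a b q
  + t * (1 - t) * ((2 * L)^-1 * dot (q - p) (q - p)).
Proof.
rewrite /paraboloid !dotE (dotC q p) (dotC b p) (dotC b q).
by field; rewrite gt_eqF.
Qed.

Lemma paraboloid_vertex c a b p (q := b + L *: a) :
  paraboloid c a b p =
  paraboloid c a b q - (2 * L)^-1 * dot (p - q) (p - q).
Proof.
rewrite /paraboloid /q !dotE (dotC b p) (dotC a p) (dotC a b).
by field; rewrite gt_eqF.
Qed.

(** The first paraboloid alone forces every [p] with [F v <= F p] into a
compact box around its vertex [v], on which the continuous [F] has a maximum. *)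
Lemma min_paraboloid_max (c : 'I_m.+1 -> R) (a b : 'I_m.+1 -> 'rV[R]_n)
    (F := min_family (fun i => paraboloid (c i) (a i) (b i))) :
  exists q, forall p, F p <= F q.
Proof.
pose v := b ord0 + L *: a ord0.
pose K := paraboloid (c ord0) (a ord0) (b ord0) v.
have FK p : F p <= K - (2 * L)^-1 * dot (p - v) (p - v).
  by rewrite /K -paraboloid_vertex; exact: (min_family_le _ ord0).
have L2 : 0 < 2 * L by rewrite mulr_gt0.
(* [F v <= F p] gives [|p - v|^2 <= r], and [r <= r^2] since [1 <= r]. *)
pose r := 2 * L * (K - F v) + 1.
have FvK : F v <= K.
  by have := FK v; rewrite subrr /dot big1 ?mulr0 ?subr0// => i _; rewrite mxE mul0r.
have r1 : 1 <= r by rewrite lerDr mulr_ge0 ?(ltW L2)// subr_ge0.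
pose I i := `[v 0 i - r, v 0 i + r]%classic.
pose A := [set p : 'rV[R]_n | forall i, I i (p ord0 i)]%classic.
have cA : compact A.
  by apply: rV_compact => i; exact: segment_compact.
have vA : A v.
  by move=> i; rewrite /I/= in_itv/= lerBlDr lerDl (le_trans ler01 r1).
have cF : {within A, continuous F}%classic.
  apply: continuous_subspaceT; apply: continuous_min_family => i.
  exact: continuous_paraboloid.
have [q _ qmax] := EVT_max_rV (ex_intro _ v vA) cA cF.
exists q => p; have [/set_mem pA|pA] := boolP (p \in A).
  by apply: qmax; rewrite inE.
apply: le_trans (qmax v _); last by rewrite inE.
rewrite leNgt; apply: contra pA => Fvp; rewrite inE => i.
have : dot (p - v) (p - v) <= r.
  have := le_trans (ltW Fvp) (FK p).
  rewrite lerBrDl -lerBrDr ler_pdivrMl// => /le_trans; apply.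
  by rewrite /r lerDl.
move=> dr; have : `|(p - v) 0 i| <= r.
  rewrite -(@ler_pXn2r _ 2)// ?nnegrE ?(le_trans ler01 r1)//.
  apply: le_trans (_ : r <= _); last by rewrite expr2 ler_peMr// (le_trans ler01).
  apply: le_trans dr; apply: le_trans (sqr_norm_le_dot (p - v)).
  by rewrite ler_pXn2r ?nnegrE// coord_le_norm.
by rewrite [(p - v) _ _]mxE [(- v) _ _]mxE ler_distl /I/= in_itv.
Qed.

(** Comparing the maximum with the points at parameter [t] on the segment from
[q] to [p] gives the inequality with the factor [1 - t] on the quadratic term;
[t] is then small. *)
Lemma min_paraboloid_strong_max (c : 'I_m.+1 -> R) (a b : 'I_m.+1 -> 'rV[R]_n)
    (F := min_family (fun i => paraboloid (c i) (a i) (b i))) :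
  exists q, forall p, F p + (2 * L)^-1 * dot (p - q) (p - q) <= F q.
Proof.
have [q qmax] := min_paraboloid_max c a b; exists q => p.
set D := _ * dot _ _.
have FD (t : R) : 0 <= t -> t <= 1 -> t * F p + t * (1 - t) * D <= t * F q.
  move=> t0 t1.
  have : (1 - t) * F q + t * F p + t * (1 - t) * D <=
      F (q + t *: (p - q)).
    apply: le_min_family => i; rewrite paraboloid_segment.
    rewrite lerD2r; apply: lerD; apply: ler_wpM2l; rewrite ?subr_ge0//.
      exact: min_family_le.
    exact: min_family_le.
  by move=> /le_trans/(_ (qmax _)); rewrite -/F; lra.
rewrite leNgt; apply/negP => qD.
have Dq : F p <= F q by exact: qmax.
have D0 : 0 < D by lra.
(* At this [t], [(1 - t) D] is half way between [F q - F p] and [D]. *)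
have D2 : 0 < 2 * D by lra.
pose t := (F p + D - F q) / (2 * D).
have t0 : 0 < t by apply: divr_gt0; lra.
have tD : t * (2 * D) = F p + D - F q by rewrite divfK// gt_eqF.
have t1 : t <= 1 by rewrite /t ler_pdivrMr//; lra.
have := FD t (ltW t0) t1.
rewrite -mulrA -mulrDr ler_pM2l// mulrBl mul1r.
by lra.
Qed.

(** [H z] is the maximum of [F z], and [G z] the maximizer.  As [z] enters
[F z p] only through [dot p z], comparing [F z] and [F w] at [G z] gives the
subgradient inequality; adding the strong maximality inequalities of [G z] and
[G w], each tested at the other point, gives cocoercivity. *)
Lemma smooth_convex_interpolation x y g :
  (forall i k, y k + dot (g k) (x i - x k)
    + (2 * L)^-1 * dot (g k - g i) (g k - g i) <= y i) ->
  exists (H : 'rV[R]_n -> R) (G : 'rV[R]_n -> 'rV[R]_n),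
  [/\ forall z w, H z + dot (G z) (w - z) <= H w,
      forall z w, dot (G w - G z) (G w - G z) <= L * dot (G w - G z) (w - z) &
      forall i, H (x i) = y i].
Proof.
move=> data.
pose F z := min_family (fun i => paraboloid (y i) (z - x i) (g i)).
have /choice[G GP] : forall z, exists q, forall p,
    F z p + (2 * L)^-1 * dot (p - q) (p - q) <= F z q.
  by move=> z; exact: min_paraboloid_strong_max.
have FE z w p : F w p = F z p + dot p (w - z).
  apply/eqP; rewrite eq_le -lerBlDr; apply/andP; split.
    apply: le_min_family => i; rewrite lerBlDr.
    apply: le_trans (min_family_le _ i _) _.
    by rewrite /paraboloid !dotE; lra.
  apply: le_min_family => i; rewrite -lerBrDr.
  apply: le_trans (min_family_le _ i _) _.
  by rewrite /paraboloid !dotE; lra.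
have L2 : 0 < (2 * L)^-1 by rewrite invr_gt0 mulr_gt0.
have Fmax z p : F z p <= F z (G z).
  by apply: le_trans (GP z p); rewrite lerDl mulr_ge0 ?dot_ge0// (ltW L2).
exists (fun z => F z (G z)), G; split=> [z w|z w|i].
- by rewrite -FE.
- have := lerD (GP z (G w)) (GP w (G z)).
  rewrite (FE z w (G z)) (FE z w (G w)).
  have -> : dot (G z - G w) (G z - G w) = dot (G w - G z) (G w - G z).
    by rewrite -opprB dotNl dotNr opprK.
  rewrite [X in _ <= L * X]dotDl dotNl => h.
  rewrite -ler_pdivrMl//.
  have -> : L^-1 = (2 * L)^-1 + (2 * L)^-1 by field; rewrite gt_eqF.
  by rewrite mulrDl; lra.
- apply/eqP; rewrite eq_le; apply/andP; split.
    apply: le_trans (min_family_le _ i _) _; rewrite /paraboloid subrr.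
    have -> : dot (G (x i)) 0 = 0 by rewrite /dot big1// => k _; rewrite mxE mulr0.
    by rewrite addr0 lerBlDr lerDl mulr_ge0 ?dot_ge0// (ltW L2).
  apply: le_trans (Fmax _ (g i)); apply: le_min_family => k.
  have := data k i; rewrite /paraboloid.
  by rewrite -(opprB (x k)) dotNr; lra.
Qed.

End Interpolation.

(** * Interpolation in the class C11 *)

(** [f = H - nu/2 |.|^2], where [H] interpolates the data shifted by
[nu/2 |.|^2].  The subgradient inequalities at both ends bound the remainder of
[H] between [0] and [(G (z + h) - G z) . h], and cocoercivity bounds the latter
by [2 nu |h|^2].  With [d = G z - G w] and [e = z - w], expanding
[|d - nu e|^2 = |d|^2 - 2 nu (d . e) + nu^2 |e|^2] shows that cocoercivity,
[|d|^2 <= 2 nu (d . e)], is exactly the Lipschitz bound for [grad f]. *)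
Lemma C11_interpolation (R : realType) (n m : nat) (nu : R)
    (x : 'I_m.+1 -> 'rV[R]_n) (y : 'I_m.+1 -> R) (g : 'I_m.+1 -> 'rV[R]_n) :
  0 < nu -> feasible nu x y g ->
  exists2 f, C11 nu f & forall i, f (x i) = y i.
Proof.
move=> nu0 feas.
have L0 : 0 < 2 * nu by rewrite mulr_gt0.
have [|H [G [Hconv Gcoc Hx]]] := @smooth_convex_interpolation R n m (2 * nu) L0
    x (fun i => y i + nu / 2 * dot (x i) (x i)) (fun i => g i + nu *: x i).
  move=> i k; have := feas i k; rewrite !sqr_enorm !dotE.
  rewrite (dotC (x k) (x i)) !(dotC (x i) (g _)) !(dotC (x k) (g _)).
  rewrite (dotC (g k) (g i)) -subr_ge0 => h; rewrite -subr_ge0.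
  apply: le_trans h _; rewrite le_eqVlt; apply/orP; left; apply/eqP.
  by field; rewrite gt_eqF.
pose f z := H z - nu / 2 * dot z z.
have fG z : differentiable f z /\ grad f z = G z - nu *: z.
  apply: (@quadratic_remainder_grad _ _ (2 * nu)) => h.
  have E : f (z + h) - f z - dot (G z - nu *: z) h =
      H (z + h) - H z - dot (G z) h - nu / 2 * dot h h.
    by rewrite /f !dotE (dotC h z); field.
  have zh : z + h - z = h by rewrite addrC addKr.
  have := Hconv z (z + h); rewrite zh => lo.
  have := Hconv (z + h) z; rewrite -(opprB (z + h)) zh dotNr => hi.
  have := Gcoc z (z + h); rewrite zh; set d := G (z + h) - G z => coc.
  have hd : dot d h = dot (G (z + h)) h - dot (G z) h by rewrite dotDl dotNl.
  have := dot_young (2 * nu) d h L0.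
  have : (2 * nu)^-1 * dot d d <= dot d h by rewrite ler_pdivrMl.
  have := mulr_ge0 (ltW nu0) (dot_ge0 h).
  by rewrite E ler_norml; lra.
exists f; last by move=> i; rewrite /f Hx addrK.
apply: lipschitz_grad_C11 => [|z|z w]; [exact: ltW|by have [] := fG z|].
rewrite (fG z).2 (fG w).2.
have -> : G z - nu *: z - (G w - nu *: w) = (G z - G w) - nu *: (z - w).
  by rewrite scalerBr !opprD !opprK addrACA.
have := Gcoc w z; move: (G z - G w) (z - w) => d e.
by rewrite !dotE (dotC e d); lra.
Qed.

(** * The objective as an interpolation error *)

Lemma is_affine_sum (R : realType) (n m : nat) (p : 'I_m -> 'rV[R]_n -> R)
    (y : 'I_m -> R) :
  (forall i, is_affine (p i)) -> is_affine (fun x => \sum_i p i x * y i).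
Proof.
move=> /choice[L /choice[c pE]].
pose S (x : 'rV[R]_n) := \sum_i L i x * y i.
have Slin : linear_for *%R S.
  move=> a u v; rewrite /S mulr_sumr -big_split; apply: eq_bigr => i _.
  by rewrite linearP mulrDl mulrA.
pose HS := GRing.isLinear.Build _ _ _ _ S Slin.
pose S' : {scalar 'rV[R]_n} := HB.pack S HS.
exists S', (\sum_i c i * y i) => x; rewrite -big_split.
by apply: eq_bigr => i _; rewrite pE mulrDl.
Qed.

Lemma interpolates_affine_interpolant (R : realType) (n : nat)
    (X : 'I_n.+1 -> 'rV[R]_n) (y : 'I_n.+1 -> R) :
  affinely_independent X -> interpolates X y (affine_interpolant X y).
Proof. by move=> indep; exact/affine_interpolantP. Qed.

(** By uniqueness of the interpolant: the right-hand side is affine and takes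
the values [y] on [X]. *)
Lemma affine_interpolant_lagrange (R : realType) (n : nat)
    (X : 'I_n.+1 -> 'rV[R]_n) (y : 'I_n.+1 -> R) x :
  affinely_independent X ->
  affine_interpolant X y x = \sum_i Defs.lagrange X i x * y i.
Proof.
move=> indep.
suff /(affine_interpolantP y _ indep) <- :
    interpolates X y (fun x => \sum_i Defs.lagrange X i x * y i) by [].
have lX i := interpolates_affine_interpolant _ _ _ (fun j => (j == i)%:R) indep.
split=> [|i]; first by apply: is_affine_sum => i; have [] := lX i.
rewrite (bigD1 i)//= big1 => [|j ji]; rewrite /Defs.lagrange (lX _).2.
  by rewrite eqxx mul1r addr0.
by rewrite eq_sym (negbTE ji) mul0r.
Qed.

Lemma sum_ell (R : realType) (n : nat) (x0 : 'rV[R]_n)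
    (X : 'I_n.+1 -> 'rV[R]_n) (y : 'I_n.+2 -> R) :
  affinely_independent X ->
  \sum_i ell X i x0 * y i =
  affine_interpolant X (fun i => y (lift ord0 i)) x0 - y ord0.
Proof.
move=> indep; rewrite big_ord_recl addrC affine_interpolant_lagrange//.
rewrite {2}/ell unlift_none mulN1r; congr (_ - _).
by apply: eq_bigr => i _; rewrite /ell liftK.
Qed.

Lemma sum_ell_comp (R : realType) (n : nat) (x0 : 'rV[R]_n)
    (X : 'I_n.+1 -> 'rV[R]_n) (f : 'rV[R]_n -> R) :
  affinely_independent X ->
  \sum_i ell X i x0 * f (points x0 X i) = affine_interpolant X (f \o X) x0 - f x0.
Proof.
move=> indep; rewrite sum_ell// /points unlift_none; congr (_ - _).
by congr (affine_interpolant X _ x0); apply/funext => i; rewrite liftK.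
Qed.

Theorem mainTheorem11 (R : realType) (n : nat) (nu : R) (x0 : 'rV[R]_n)
    (X : 'I_n.+1 -> 'rV[R]_n) (nu_gt0 : 0 < nu)
    (X_indep : affinely_independent X) :
  worst_error nu x0 X = finite_optimum nu x0 X.
Proof.
have error_le f : C11 nu f ->
    ((affine_interpolant X (f \o X) x0 - f x0)%:E <= finite_optimum nu x0 X)%E.
  move=> fC; rewrite -sum_ell_comp//; apply: ereal_sup_ubound.
  exists (f \o points x0 X), (grad f \o points x0 X); split=> //.
  exact: C11_feasible.
apply/eqP; rewrite eq_le; apply/andP; split; apply: ge_ereal_sup.
  move=> _ [f fC <-].
  have [_|_] := ger0P (affine_interpolant X (f \o X) x0 - f x0).
    exact: error_le.
  have := error_le _ (C11_opp nu f (ltW nu_gt0) fC).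
  rewrite -!sum_ell_comp// -sumrN.
  by under eq_bigr do rewrite mulrN.
move=> _ [y [g [yg ->]]].
have [f fC fy] := C11_interpolation _ _ _ nu _ _ _ nu_gt0 yg.
have -> : \sum_i ell X i x0 * y i = affine_interpolant X (f \o X) x0 - f x0.
  by rewrite -sum_ell_comp//; apply: eq_bigr => i _; rewrite fy.
apply: le_trans (_ : (`|affine_interpolant X (f \o X) x0 - f x0|%:E <= _)%E).
  by rewrite lee_fin ler_norm.
by apply: ereal_sup_ubound; exists f.
Qed.
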